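(* Let $\mathcal{X}=(\mathcal{V},\varrho,\upsilon)$ be a fuzzy graph. Then $$ir_s(\mathcal{X})\le\gamma_s(\mathcal{X})\le i_s(\mathcal{X})\le\beta_s(\mathcal{X})\le\Gamma_s(\mathcal{X})\le IR_s(\mathcal{X}).$$
   Context: A fuzzy graph $\mathcal{X}=(\mathcal{V},\varrho,\upsilon)$ consists of a nonempty finite set $\mathcal{V}$ of vertices, a function $\varrho:\mathcal{V}\to[0,1]$ and a symmetric function $\upsilon:\mathcal{V}\times\mathcal{V}\to[0,1]$ with $\upsilon(ab)\le\min(\varrho(a),\varrho(b))$ for all $a,b$, and no loops ($\upsilon(aa)=0$). Put $\varrho^*=\{a:\varrho(a)>0\}$ and $\upsilon^*=\{ab:\upsilon(ab)>0\}$; it is assumed that $\mathcal{V}=\varrho^*$, and the elements of $\upsilon^*$ are called edges. A path is a sequence of distinct vertices $a_1,\dots,a_n$ with $\upsilon(a_ia_{i+1})>0$ for all $i<n$; its strength is the minimum of the weights $\upsilon$ of its edges. The strength of connectedness between $a$ and $b$ is the maximum of the strengths of all paths from $a$ to $b$ (and $0$ if there is none). An edge $ab$ is strong if $\upsilon(ab)$ is at least the strength of connectedness between $a$ and $b$ in the fuzzy graph obtained by deleting the edge $ab$. Write $N_s[a]=\{a\}\cup\{b: ab\text{ is a strong edge}\}$. A set $\mathcal{D}\subseteq\mathcal{V}$ is a strong dominating set (SDS) if every $b\in\mathcal{V}\setminus\mathcal{D}$ is joined by a strong edge to some $a\in\mathcal{D}$. An SDS $\mathcal{D}$ is a minimal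 strong dominating set (MSDS) if $\mathcal{D}\setminus\{a\}$ is not an SDS for every $a\in\mathcal{D}$. For $a\in\mathcal{S}\subseteq\mathcal{V}$ the private neighborhood is $P_{N_s}[a,\mathcal{S}]=N_s[a]\setminus\bigcup_{b\in\mathcal{S}\setminus\{a\}}N_s[b]$. A set $\mathcal{S}$ is irredundant if $P_{N_s}[a,\mathcal{S}]\ne\emptyset$ for all $a\in\mathcal{S}$, and maximal irredundant if in addition $\mathcal{S}\cup\{a\}$ is not irredundant for every $a\in\mathcal{V}\setminus\mathcal{S}$. A set is independent if no two of its vertices are joined by a strong edge. An independent dominating set is a set that is both an SDS and independent. The weight of $\mathcal{S}\subseteq\mathcal{V}$ is $W(\mathcal{S})=\sum_{a\in\mathcal{S}}\min\{\upsilon(ab): ab \text{ is a strong edge}\}$; whenever weights are used it is understood that every vertex is incident with at least one strong edge. Then: $ir_s$ is the minimum weight of a maximal irredundant set; $IR_s$ is the maximum weight of an irredundant set; $\gamma_s$ is the minimum weight of an SDS; $\Gamma_s$ is the maximum weight of an MSDS; $i_s$ is the minimum weight of an independent dominating set; $\beta_s$ is the maximum weight of an independent set. *)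

(* Defs.v *)
From HB Require Import structures.
From mathcomp Require Import all_boot all_order all_algebra.
Set Implicit Arguments.
Unset Strict Implicit.
Unset Printing Implicit Defensive.
Import Order.TTheory GRing.Theory Num.Theory.
Local Open Scope ring_scope.

(* The vertex set is the whole finite type V; [rho_gt0] is the assumption
   that V coincides with the support of rho. *)
Record fuzzy_graph (R : realFieldType) (V : finType) := FuzzyGraph {
  rho : V -> R;
  upsilon : V -> V -> R;
  vertex_nonempty : (0 < #|V|)%N;
  rho_itv : forall a, 0 <= rho a <= 1;
  upsilon_itv : forall a b, 0 <= upsilon a b <= 1;
  upsilon_sym : forall a b, upsilon a b = upsilon b a;
  upsilon_le_rho : forall a b, upsilon a b <= Num.min (rho a) (rho b);
  upsilon_loop : forall a, upsilon a a = 0;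
  rho_gt0 : forall a, 0 < rho a
}.

Section EdgeDeletion.
Variables (R : realFieldType) (V : finType) (X : fuzzy_graph R V) (a b : V).

Definition is_pair (x y : V) : bool :=
  ((x == a) && (y == b)) || ((x == b) && (y == a)).

Definition del_upsilon (x y : V) : R :=
  if is_pair x y then 0 else upsilon X x y.

Lemma del_upsilon_itv x y : 0 <= del_upsilon x y <= 1.
Proof.
by rewrite /del_upsilon; case: ifP => _; rewrite ?lexx ?ler01 ?upsilon_itv.
Qed.

Lemma del_upsilon_sym x y : del_upsilon x y = del_upsilon y x.
Proof.
rewrite /del_upsilon upsilon_sym /is_pair orbC.
by rewrite (andbC (x == b)) (andbC (x == a)).
Qed.

Lemma del_upsilon_le_rho x y :
  del_upsilon x y <= Num.min (rho X x) (rho X y).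
Proof.
rewrite /del_upsilon; case: ifP => _; last exact: upsilon_le_rho.
by rewrite le_min !ltW ?rho_gt0.
Qed.

Lemma del_upsilon_loop x : del_upsilon x x = 0.
Proof. by rewrite /del_upsilon upsilon_loop if_same. Qed.

Definition del_edge : fuzzy_graph R V :=
  FuzzyGraph (vertex_nonempty X) (rho_itv X) del_upsilon_itv del_upsilon_sym
    del_upsilon_le_rho del_upsilon_loop (rho_gt0 X).

End EdgeDeletion.

Section Connectedness.
Variables (R : realFieldType) (V : finType) (X : fuzzy_graph R V).
Implicit Types a b : V.

Definition edge : rel V := fun a b => 0 < upsilon X a b.

(* The vertex sequence of the path is a :: p. *)
Definition is_path a b (p : seq V) : bool :=
  [&& path edge a p, uniq (a :: p) & last a p == b].

(* The default value 1 bounds every edge weight, so it only matters for the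
   one-vertex path, which never joins the ends of an edge. *)
Fixpoint path_strength a (p : seq V) : R :=
  if p is c :: q then Num.min (upsilon X a c) (path_strength c q) else 1.

(* Since a :: p has no repetition, size p <= #|V|, so the bounded sequences
   contain all paths. *)
Definition conn_strength a b : R :=
  \big[Num.max/0]_(p : #|V|.-bseq V | is_path a b p) path_strength a p.

End Connectedness.

Section StrongDomination.
Variables (R : realFieldType) (V : finType) (X : fuzzy_graph R V).
Implicit Types (a b : V) (S D : {set V}).

Definition strong_edge a b : bool :=
  edge X a b && (conn_strength (del_edge X a b) a b <= upsilon X a b).

Definition strong_nbhd a : {set V} := a |: [set b | strong_edge a b].

Definition sds D : bool :=
  [forall b in ~: D, exists a in D, strong_edge a b].

Definition msds D : bool := sds D && [forall a in D, ~~ sds (D :\ a)].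

Definition private_nbhd a S : {set V} :=
  strong_nbhd a :\: \bigcup_(b in S :\ a) strong_nbhd b.

Definition irredundant S : bool :=
  [forall a in S, private_nbhd a S != set0].

Definition max_irredundant S : bool :=
  irredundant S && [forall a in ~: S, ~~ irredundant (a |: S)].

Definition independent S : bool :=
  [forall a in S, forall b in S, (a != b) ==> ~~ strong_edge a b].

Definition independent_dominating S : bool := sds S && independent S.

(* As upsilon <= 1, the default value 1 does not affect the minimum when a is
   incident with a strong edge. *)
Definition vertex_weight a : R :=
  \big[Num.min/1]_(b | strong_edge a b) upsilon X a b.

Definition weight S : R := \sum_(a in S) vertex_weight a.

(* Weights are monotone in S and nonnegative, so these are the actual minimum
   and maximum over P as soon as some set satisfies P. *)
Definition min_weight (P : pred {set V}) : R :=
  \big[Num.min/weight setT]_(S | P S) weight S.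

Definition max_weight (P : pred {set V}) : R :=
  \big[Num.max/0]_(S | P S) weight S.

Definition ir_s : R := min_weight max_irredundant.
Definition IR_s : R := max_weight irredundant.
Definition gamma_s : R := min_weight sds.
Definition Gamma_s : R := max_weight msds.
Definition i_s : R := min_weight independent_dominating.
Definition beta_s : R := max_weight independent.

End StrongDomination.

(* Main.v *)
(** Strong adjacency is symmetric, because reversing a path preserves its
    strength. The inequalities are then the classical domination chain: a
    minimal dominating set is maximal irredundant, and a maximal independent
    set is minimal dominating. Since vertex weights are nonnegative, shrinking
    a set lowers its weight and enlarging it raises its weight. *)
Require Import Defs.
From mathcomp Require Import all_boot all_order all_algebra.
Set Implicit Arguments.
Unset Strict Implicit.
Unset Printing Implicit Defensive.
Import Order.TTheory GRing.Theory Num.Theory.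
Local Open Scope ring_scope.

Section StrongEdgeSymmetry.
Variables (R : realFieldType) (V : finType).
Implicit Types (X Y : fuzzy_graph R V) (a b : V) (p : seq V).

(** Turns a bound on a minimum into an edgewise condition, which [rev_path] can reverse. The
    conjunct [t <= 1] stems from the default strength 1 of the one-vertex path. *)
Lemma le_path_strength X t a p :
  (t <= path_strength X a p)
    = (t <= 1) && path (fun x y => t <= upsilon X x y) a p.
Proof.
elim: p a => [|c p IHp] a /=; first by rewrite andbT.
by rewrite le_min IHp andbCA.
Qed.

Lemma last_rev_belast a p : last (last a p) (rev (belast a p)) = a.
Proof. by case: p => //= c p; rewrite rev_cons last_rcons. Qed.

(** Two graphs appear because reversal will relate [del_edge X a b] to [del_edge X b a], whose
    weights agree pointwise: [is_pair] merely swaps its disjuncts. *)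
Lemma is_path_rev X Y a b p : upsilon X =2 upsilon Y ->
  is_path X a b p -> is_path Y b a (rev (belast a p)).
Proof.
move=> eqXY /and3P[pathp uniqp /eqP <-]; apply/and3P; split.
- rewrite rev_path; apply: sub_path pathp => x y.
  by rewrite /edge -eqXY upsilon_sym.
- by rewrite -rev_rcons rev_uniq -lastI.
- by rewrite last_rev_belast.
Qed.

Lemma path_strength_rev X Y a p : upsilon X =2 upsilon Y ->
  path_strength X a p <= path_strength Y (last a p) (rev (belast a p)).
Proof.
(* The threshold is the strength of the path itself. *)
move=> eqXY; have := lexx (path_strength X a p).
rewrite le_path_strength => /andP[le1 pathp].
rewrite le_path_strength le1 rev_path /=; apply: sub_path pathp => x y.
by rewrite -eqXY upsilon_sym.
Qed.

Lemma conn_strength_rev_le X Y a b : upsilon X =2 upsilon Y ->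
  conn_strength X a b <= conn_strength Y b a.
Proof.
move=> eqXY; apply: bigmax_le => [|p pathp]; first exact: bigmax_ge_id.
(* The reversed path must again fit the length bound to index a term of the maximum. *)
have size_rev_p : (size (rev (belast a p)) <= #|V|)%N.
  by rewrite size_rev size_belast size_bseq.
have := path_strength_rev a p eqXY.
have /and3P[_ _ /eqP ->] := pathp; move/le_trans; apply.
exact: (le_bigmax_cond _ (j := Bseq size_rev_p)
          (fun q : #|V|.-bseq V => path_strength Y b q)
          (is_path_rev eqXY pathp)).
Qed.

Lemma strong_edge_sym X : symmetric (strong_edge X).
Proof.
suff imp a b : strong_edge X a b -> strong_edge X b a.
  by move=> a b; apply/idP/idP; apply: imp.
rewrite /strong_edge /edge upsilon_sym => /andP[-> /=].
apply: le_trans; apply: conn_strength_rev_le => x y /=.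
by rewrite /del_upsilon /is_pair orbC.
Qed.

Lemma strong_edge_irrefl X : irreflexive (strong_edge X).
Proof. by move=> a; rewrite /strong_edge /edge upsilon_loop ltxx. Qed.

End StrongEdgeSymmetry.

Section Domination.
Variables (R : realFieldType) (V : finType) (X : fuzzy_graph R V).
Implicit Types (a b : V) (S T D : {set V}) (P Q : pred {set V}).

Lemma sdsP D :
  reflect (forall b, b \notin D -> exists2 a, a \in D & strong_edge X a b)
          (sds X D).
Proof.
apply: (iffP forall_inP) => [domD b bD | domD b].
  by apply/exists_inP/domD; rewrite inE.
by rewrite inE => /domD/exists_inP.
Qed.

Lemma independentP S :
  reflect {in S &, forall a b, ~~ strong_edge X a b} (independent X S).
Proof.
apply: (iffP forall_inP) => [indS a b aS bS | indS a aS].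
  have [<- | nab] := eqVneq a b; first by rewrite strong_edge_irrefl.
  by have /forall_inP/(_ b bS)/implyP := indS a aS; apply.
by apply/forall_inP => b bS; apply/implyP => _; apply: indS.
Qed.

Lemma sds_bigcup_nbhd D b : sds X D -> b \in \bigcup_(a in D) strong_nbhd X a.
Proof.
move=> /sdsP domD; apply/bigcupP.
have [bD | /domD[a aD ab]] := boolP (b \in D).
  by exists b => //; rewrite setU11.
by exists a => //; rewrite !inE ab orbT.
Qed.

(** A vertex [b] that [D :\ a] leaves undominated is a private neighbor of [a]: either [b] is [a],
    or [b] lies outside [D] and its dominator in [D] can only be [a]. *)
Lemma msds_irredundant D : msds X D -> irredundant X D.
Proof.
case/andP=> /sdsP domD /forall_inP minD; apply/forall_inP => a aD.
have /forall_inPn[b] := minD a aD; rewrite inE => bDa /exists_inPn nab.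
apply/set0Pn; exists b; rewrite inE; apply/andP; split.
  apply/bigcupP => -[c cDa]; rewrite !inE (negPf (nab c cDa)) orbF.
  by move=> /eqP bc; rewrite bc cDa in bDa.
move: bDa; rewrite !inE negb_and negbK; have [// | nba /=] := eqVneq b a.
move=> /domD[c cD cb]; have [<- // | nca] := eqVneq c a.
by have := nab c; rewrite !inE nca cD cb => /(_ isT).
Qed.

Lemma msds_max_irredundant D : msds X D -> max_irredundant X D.
Proof.
move=> mD; rewrite /max_irredundant msds_irredundant //=.
have /andP[domD _] := mD.
apply/forall_inP => a; rewrite inE => aD; apply/forall_inPn.
(* The added vertex itself has no private neighbor, since the closed neighborhoods of [D] already
   cover all vertices. *)
exists a; rewrite ?setU11 // negbK /private_nbhd setU1K //.
by rewrite setD_eq0; apply/subsetP => b _; apply: sds_bigcup_nbhd.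
Qed.

Lemma sds_contains_msds D : sds X D -> exists2 S, msds X S & S \subset D.
Proof.
move=> domD; have [S /minsetP[domS minS] sSD] := minset_exists (P := sds X) domD.
exists S => //; rewrite /msds domS; apply/forall_inP => a aS.
apply/negP => /minS/(_ (subsetDl _ _)) eqS.
by have := setD11 a S; rewrite eqS aS.
Qed.

(** By independence, a vertex removed from [S] has no strong neighbor in the rest, so it is left
    undominated. *)
Lemma independent_dominating_msds S : independent_dominating X S -> msds X S.
Proof.
case/andP=> domS /independentP indS; rewrite /msds domS.
apply/forall_inP => a aS; apply/sdsP => /(_ a); rewrite setD11 => /(_ isT)[b].
by case/setD1P=> _ bS; apply/negP/indS.
Qed.

(** An inclusion-maximal independent superset works: a vertex it failed to dominate could be added
    to it. *)
Lemma independent_extend S : independent X S ->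
  exists2 T, independent_dominating X T & S \subset T.
Proof.
move=> indS.
have [T /maxsetP[indT maxT] sST] := maxset_exists (P := independent X) indS.
exists T => //; rewrite /independent_dominating indT andbT.
apply/sdsP => b bT; apply/exists_inP; apply: contraNT bT => /exists_inPn nTb.
(* Maximality would give [b |: T = T], hence [b \in T]; independence of [b |: T] remains. *)
rewrite -(maxT (b |: T)) ?setU11 ?subsetUr //.
apply/independentP => x y /setU1P[-> | xT] /setU1P[-> | yT].
- by rewrite strong_edge_irrefl.
- by rewrite strong_edge_sym nTb.
- exact: nTb.
- by have /independentP := indT; apply.
Qed.

Lemma independent0 : independent X set0.
Proof. by apply/independentP => a b; rewrite inE. Qed.

Lemma vertex_weight_ge0 a : 0 <= vertex_weight X a.
Proof.
by apply: le_bigmin => // b _; have /andP[] := upsilon_itv X a b.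
Qed.

Lemma weight_subset S T : S \subset T -> weight X S <= weight X T.
Proof.
move=> sST; rewrite /weight [leRHS](big_setID S) (setIidPr sST) /= lerDl.
by apply: sumr_ge0 => a _; apply: vertex_weight_ge0.
Qed.

Lemma min_weight_le P S : P S -> min_weight X P <= weight X S.
Proof. exact: bigmin_le_cond. Qed.

Lemma max_weight_ge P S : P S -> weight X S <= max_weight X P.
Proof. exact: le_bigmax_cond. Qed.

(** If no set satisfies [Q], the right side is the default [weight setT], which still bounds the
    left side. *)
Lemma min_weight_dominated P Q :
    (forall S, Q S -> exists2 T, P T & T \subset S) ->
  min_weight X P <= min_weight X Q.
Proof.
move=> PQ; apply: le_bigmin => [|S /PQ[T PT sTS]]; first exact: bigmin_le_id.
exact: le_trans (min_weight_le PT) (weight_subset sTS).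
Qed.

Lemma max_weight_dominated P Q :
    (forall S, P S -> exists2 T, Q T & S \subset T) ->
  max_weight X P <= max_weight X Q.
Proof.
move=> PQ; apply: bigmax_le => [|S /PQ[T QT sST]]; first exact: bigmax_ge_id.
exact: le_trans (weight_subset sST) (max_weight_ge QT).
Qed.

End Domination.

Theorem theorem3p22 (R : realFieldType) (V : finType) (X : fuzzy_graph R V)
    (hX : forall a : V, exists b : V, strong_edge X a b) :
  [/\ ir_s X <= gamma_s X,
      gamma_s X <= i_s X,
      i_s X <= beta_s X,
      beta_s X <= Gamma_s X &
      Gamma_s X <= IR_s X].
Proof.
split.
- apply: min_weight_dominated => D /sds_contains_msds[S mS sSD].
  by exists S; first exact: msds_max_irredundant.
- by apply: min_weight_dominated => D /andP[domD _]; exists D.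
(* A minimum is compared with a maximum here, so one set counted by both suffices; extending the
   empty set provides it. *)
- have [S idS _] := independent_extend (independent0 X).
  have /andP[_ indS] := idS.
  exact: le_trans (min_weight_le X idS) (max_weight_ge X indS).
- apply: max_weight_dominated => S /independent_extend[T idT sST].
  by exists T; first exact: independent_dominating_msds.
- apply: max_weight_dominated => D /msds_irredundant irrD.
  by exists D.
Qed.
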